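(* Let $\mathbb{Q}$ be the hierarchical mesh associated with a hierarchy of subdomains $\{\Omega_0,\dots,\Omega_n\}$ of $\Omega=[0,1]^d$ of depth $n$. Then $\mathbb{Q}$ is a weakly admissible hierarchical mesh if and only if, for every $\ell\in\{1,\dots,n-1\}$ and every cell $Q\in\mathcal{Q}_\ell$ such that $Q\subset\omega_\ell$, it holds that $\mathcal{N}_{\mathrm{parent}(Q)}\cap\Omega_0\subset\Omega_{\ell-1}$.
   Context: Fix integers $d\ge 1$, $p\ge 1$ and let $\Omega=\Omega_0=[0,1]^d$. For $\ell\in\mathbb{Z}$, $\mathcal{Q}^\infty_\ell$ is the set of closed cubes $2^{-\ell}(\mathbf{k}+[0,1]^d)$, $\mathbf{k}\in\mathbb{Z}^d$ (cells of level $\ell$); for $\ell\ge 0$, $\mathcal{Q}_\ell$ is the set of cells of level $\ell$ contained in $\Omega$. $\mathbf{B}^\infty_{\mathbf{p},\ell}$ is the set of cubes $\prod_{i=1}^d[\tfrac{k_i}{2^\ell},\tfrac{k_i+p+1}{2^\ell}]$, $\mathbf{k}\in\mathbb{Z}^d$ (supports of the cardinal tensor-product B-splines of degree $p$ and level $\ell$). For $Q\in\mathcal{Q}^\infty_\ell$: $\mathrm{parent}(Q)$ is the unique cell of level $\ell-1$ containing $Q$; $\widehat{Q}$ is the union of all $C\in\mathbf{B}^\infty_{\mathbf{p},\ell}$ with $Q\subset C$; and $\mathcal{N}_Q:=\bigcup\{\mathrm{parent}(Q^* ) : Q^*\in\mathcal{Q}^\infty_\ell,\ Q^*\subset\widehat{Q}\}$.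 For $\ell\ge0$, $\mathcal{B}_\ell$ is the tensor-product B-spline basis on $\Omega$ with mesh $\mathcal{Q}_\ell$, degree $p$ in each direction and maximum smoothness; supports are intersected with $\Omega$. For $Q\in\mathcal{Q}_\ell$, the support extension is $\tilde Q:=\bigcup\{\operatorname{supp}\beta : \beta\in\mathcal{B}_\ell,\ Q\subset\operatorname{supp}\beta\}$, equivalently $\tilde Q=\widehat Q\cap\Omega_0$. A hierarchy of subdomains of depth $n$ is $\{\Omega_0,\dots,\Omega_n\}$ with $\Omega=\Omega_0\supset\Omega_1\supset\dots\supset\Omega_{n-1}\supset\Omega_n=\emptyset$, where $\Omega_\ell$ is a union of cells of level $\ell-1$ for $\ell=1,\dots,n-1$. Its hierarchical mesh is $\mathbb{Q}:=\bigcup_{\ell=0}^{n-1}\{Q\in\mathcal{Q}_\ell : Q\subset\Omega_\ell,\ Q\not\subset\Omega_{\ell+1}\}$. For $\ell=0,\dots,n-1$, $\omega_\ell:=\bigcup\{Q\in\mathcal{Q}_\ell : \tilde Q\subset\Omega_\ell\}$. The mesh $\mathbb{Q}$ is a weakly admissible hierarchical mesh (WAHM) if $\omega_\ell\subset\omega_{\ell-1}$ for all $\ell=1,\dots,n-1$. *)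

(* Defs.v *)
From HB Require Import structures.
From mathcomp Require Import all_boot all_order all_algebra.
From mathcomp Require Import all_classical all_reals all_analysis.

Set Implicit Arguments.
Unset Strict Implicit.
Unset Printing Implicit Defensive.

Import Order.TTheory GRing.Theory Num.Theory.
Import numFieldNormedType.Exports.

Local Open Scope classical_set_scope.
Local Open Scope ring_scope.

Section Meshes.
Variables (R : realType) (d : nat).

Definition unit_cube : set 'rV[R]_d := [set x | forall i, 0 <= x 0 i <= 1].

(* Levels are integers: the neighbourhood of a cell of level 0 involves cells
   of level -1. *)
Definition cell (l : int) (k : 'I_d -> int) : set 'rV[R]_d :=
  [set x | forall i, (k i)%:~R / 2 ^ l <= x 0 i <= (k i + 1)%:~R / 2 ^ l].

Definition cells (l : int) : set (set 'rV[R]_d) :=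
  [set Q | exists k, Q = cell l k].

Definition cells_in (l : nat) : set (set 'rV[R]_d) :=
  [set Q | cells l Q /\ Q `<=` unit_cube].

Definition bspline_cube (p : nat) (l : int) (k : 'I_d -> int) :
    set 'rV[R]_d :=
  [set x | forall i,
     (k i)%:~R / 2 ^ l <= x 0 i <= (k i + p%:Z + 1)%:~R / 2 ^ l].

Definition bspline_cubes (p : nat) (l : int) : set (set 'rV[R]_d) :=
  [set C | exists k, C = bspline_cube p l k].

(* A cell carries its level l as a separate argument. *)
Definition parent (l : int) (Q : set 'rV[R]_d) : set 'rV[R]_d :=
  get [set P | cells (l - 1) P /\ Q `<=` P].

Definition hat (p : nat) (l : int) (Q : set 'rV[R]_d) : set 'rV[R]_d :=
  \bigcup_(C in [set C | bspline_cubes p l C /\ Q `<=` C]) C.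

Definition neighbourhood (p : nat) (l : int) (Q : set 'rV[R]_d) :
    set 'rV[R]_d :=
  \bigcup_(Q' in [set Q' | cells l Q' /\ Q' `<=` hat p l Q]) parent l Q'.

(* Cox-de Boor recursion for the knots 0, 1, ..., p + 1. *)
Fixpoint cardinal_bspline (p : nat) (t : R) : R :=
  match p with
  | 0%N => if 0 <= t < 1 then 1 else 0
  | q.+1 => (t * cardinal_bspline q t
             + (q.+2%:R - t) * cardinal_bspline q (t - 1)) / q.+1%:R
  end.

Definition tensor_bspline (p l : nat) (k : 'I_d -> int) (x : 'rV[R]_d) : R :=
  \prod_(i < d) cardinal_bspline p (2 ^+ l * x 0 i - (k i)%:~R).

(* Functions on the unit cube are represented by their extension by 0. The
   basis consists of the cardinal B-splines of level l restricted to the unit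
   cube, without those whose restriction vanishes identically. *)
Definition bspline_basis (p l : nat) : set ('rV[R]_d -> R) :=
  [set b | (exists k, b = patch (fun=> 0) unit_cube (tensor_bspline p l k))
           /\ exists x, b x != 0].

Definition supp (f : 'rV[R]_d -> R) : set 'rV[R]_d :=
  closure [set x | f x != 0].

Definition support_extension (p l : nat) (Q : set 'rV[R]_d) : set 'rV[R]_d :=
  \bigcup_(b in [set b | bspline_basis p l b /\ Q `<=` supp b]) supp b.

Record is_hierarchy (n : nat) (Omega : nat -> set 'rV[R]_d) : Prop :=
  IsHierarchy {
    hierarchy_first : Omega 0%N = unit_cube;
    hierarchy_last : Omega n = set0;
    hierarchy_nested : forall l, (l < n)%N -> Omega l.+1 `<=` Omega l;
    hierarchy_cells : forall l, (0 < l < n)%N ->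
      exists2 F : set (set 'rV[R]_d),
        F `<=` cells (l%:Z - 1) & Omega l = \bigcup_(Q in F) Q
  }.

Definition hierarchical_mesh (n : nat) (Omega : nat -> set 'rV[R]_d) :
    set (set 'rV[R]_d) :=
  \bigcup_(l in [set l | (l < n)%N])
    [set Q | [/\ cells_in l Q, Q `<=` Omega l & ~ (Q `<=` Omega l.+1)]].

Definition omega (p : nat) (Omega : nat -> set 'rV[R]_d) (l : nat) :
    set 'rV[R]_d :=
  \bigcup_(Q in [set Q | cells_in l Q /\ support_extension p l Q `<=` Omega l])
    Q.

(* Weak admissibility of the mesh M relative to the hierarchy it comes from. *)
Definition weakly_admissible (p n : nat) (Omega : nat -> set 'rV[R]_d)
    (M : set (set 'rV[R]_d)) : Prop :=
  M = hierarchical_mesh n Omega /\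
  forall l, (0 < l < n)%N -> omega p Omega l `<=` omega p Omega l.-1.

End Meshes.

(* Main.v *)
Require Import Defs.
From HB Require Import structures.
From mathcomp Require Import all_boot all_order all_algebra.
From mathcomp Require Import all_classical all_reals all_analysis.
From mathcomp Require Import zify ring lra.

Set Implicit Arguments.
Unset Strict Implicit.
Unset Printing Implicit Defensive.

Import Order.TTheory GRing.Theory Num.Theory.
Import numFieldNormedType.Exports.

Local Open Scope classical_set_scope.
Local Open Scope ring_scope.

(** A cell is identified with its integer multi-index k; the parent of k has
    multi-index k / 2 rounded down. Whether a cell lies in another cell, in a
    spline cube or in the unit cube is decided by its centre, hence by
    inequalities between integers. In particular, if the centre of a cell
    lies in a union of cells of the previous level, then the whole parent does.

    The support of a B-spline restricted to the unit cube is the intersection of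
    its spline cube with the unit cube as soon as the spline cube contains a
    cell of the unit cube ([sub_supp_restricted_bspline]), because the cardinal
    B-spline is positive in the interior of its support. So the support
    extension of Q is the hat of Q cut by the unit cube ([support_extensionE]).

    Let Q be a cell of level l contained in omega_l and P its parent.

    If omega_l is contained in omega_(l-1), the centre of Q lies in a cell of
    level l-1 whose support extension is contained in Omega_(l-1), and that cell
    can only be P. For l = 1 there is nothing more to say, since Omega_0 is the
    unit cube; let l be at least 2. A point x of the unit cube in the
    neighbourhood of P lies in the parent of some cell of the hat of P, which
    may leave the unit cube, but its index can be clamped
    ([neighbourhood_clamp]): the clamped cell lies in the support extension of
    P, hence in Omega_(l-1). As Omega_(l-1) is a union of cells of level l-2, it
    contains the parent of the clamped cell, and so x.

    Conversely, the hat of P is contained in the neighbourhood of P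
    ([hat_sub_neighbourhood]), so the condition on neighbourhoods gives that the
    support extension of P is contained in Omega_(l-1). Thus P, and with it
    Q, is contained in omega_(l-1). *)

(** * Cells and their centres *)

Section Cells.
Variables (R : realType) (d : nat).
Implicit Types (l : int) (k m : 'I_d -> int) (x : 'rV[R]_d).

Lemma exp2z_gt0 l : 0 < 2 ^ l :> R.
Proof. by rewrite exprz_gt0. Qed.

Lemma exp2z_pred l : 2 ^ l = 2 * 2 ^ (l - 1) :> R.
Proof. by rewrite -{2}(expr1z 2) -expfzDr// addrC subrK. Qed.

Lemma in_cell l k x :
  cell l k x <-> forall i, (k i)%:~R <= x 0 i * 2 ^ l <= (k i)%:~R + 1.
Proof.
split=> xk i; have := xk i;
  by rewrite ler_pdivrMr ?ler_pdivlMr ?exp2z_gt0// intrD.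
Qed.

Lemma in_bspline_cube p l k x : bspline_cube p l k x <->
  forall i, (k i)%:~R <= x 0 i * 2 ^ l <= (k i)%:~R + p%:R + 1.
Proof.
split=> xk i; have := xk i;
  by rewrite ler_pdivrMr ?ler_pdivlMr ?exp2z_gt0// !intrD.
Qed.

Definition cell_center l k : 'rV[R]_d :=
  \row_i (((k i)%:~R + 2^-1) / 2 ^ l).

Lemma cell_centerE l k i : cell_center l k 0 i * 2 ^ l = (k i)%:~R + 2^-1.
Proof. by rewrite mxE divfK// gt_eqF ?exp2z_gt0. Qed.

Lemma cell_center_in l k : cell l k (cell_center l k).
Proof. by apply/in_cell => i; rewrite cell_centerE; apply/andP; split; lra. Qed.

(** Scaled coordinates of centres are half-integers and those of faces are
    integers, so comparing them loses no information when it is done on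
    integer parts. *)
Lemma half_itv (a b c : int) :
  (a%:~R <= c%:~R + 2^-1 :> R) && (c%:~R + 2^-1 <= b%:~R + 1 :> R)
    = (a <= c <= b).
Proof.
have E (e f : int) : (e%:~R <= f%:~R + 2^-1 :> R) = (e <= f).
  apply/idP/idP => [ef|]; last by rewrite -(ler_int R); lra.
  have : e%:~R < (f + 1)%:~R :> R by rewrite intrD; lra.
  by rewrite ltr_int; lia.
rewrite E; congr (_ && _); apply/idP/idP => [cb|]; last first.
  by rewrite -(ler_int R); lra.
have : c%:~R < (b + 1)%:~R :> R by rewrite intrD; lra.
by rewrite ltr_int; lia.
Qed.

(** In scaled coordinates of the previous level, the centre is at distance 1/4
    from the nearest integers, so only one cell of that level contains it. *)
Lemma center_in_parent l k m : cell (l - 1) m (cell_center l k) ->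
  m = fun i => (k i %/ 2)%Z.
Proof.
move=> /in_cell h; apply/funext => i.
have := h i; have := cell_centerE l k i; rewrite exp2z_pred.
set y := cell_center l k 0 i => e h'.
have : ((2 * m i)%:~R <= (k i)%:~R + 2^-1 :> R) &&
    ((k i)%:~R + 2^-1 <= (2 * m i + 1)%:~R + 1 :> R).
  by rewrite intrD !intrM; apply/andP; split; lra.
by rewrite half_itv; lia.
Qed.

Lemma cell_sub_half l k :
  cell l k `<=` cell (R:=R) (l - 1) (fun i => (k i %/ 2)%Z).
Proof.
move=> x /in_cell xk; apply/in_cell => i; have := xk i; rewrite exp2z_pred.
have e1 : ((2 * (k i %/ 2)%Z)%:~R <= (k i)%:~R :> R) by rewrite ler_int; lia.
have e2 : ((k i)%:~R <= (2 * (k i %/ 2)%Z + 1)%:~R :> R).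
  by rewrite ler_int; lia.
by move: e1 e2; rewrite intrD !intrM => e1 e2 h; apply/andP; split; lra.
Qed.

Lemma parent_cell l k :
  parent l (cell l k) = cell (R:=R) (l - 1) (fun i => (k i %/ 2)%Z).
Proof.
have [] := @getPex _ [set P | cells (R:=R) (l - 1) P /\ cell l k `<=` P].
  by exists (cell (l - 1) (fun i => (k i %/ 2)%Z)); split;
    [eexists | exact: cell_sub_half].
rewrite -/(parent l (cell l k)) => -[m ->] /(_ _ (cell_center_in l k)).
by move/center_in_parent ->.
Qed.

Lemma in_unit_cube (l : nat) x :
  unit_cube x <-> forall i, 0 <= x 0 i * 2 ^ l%:Z <= 2 ^ l%:Z.
Proof.
have l0 := exp2z_gt0 l%:Z.
by split=> h i; have := h i; rewrite pmulr_lge0// ger_pMl.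
Qed.

Lemma exp2zE (l : nat) : 2 ^ l%:Z = ((2 ^ l)%N%:Z)%:~R :> R.
Proof. by rewrite -exprnP -pmulrn natrX. Qed.

Lemma cell_sub_unit_cube (l : nat) k :
  cell (R:=R) l%:Z k `<=` @unit_cube R d <->
  forall i, 0 <= k i < (2 ^ l)%N%:Z.
Proof.
split=> [h i|h x /in_cell xk].
  have /(in_unit_cube l)/(_ i) := h _ (cell_center_in _ k).
  rewrite cell_centerE exp2zE.
  have -> : (2 ^ l)%N%:Z = ((2 ^ l)%N%:Z - 1) + 1 by rewrite subrK.
  by rewrite [in X in _ <= _ <= X -> _]intrD (half_itv 0); lia.
apply/(in_unit_cube l) => i; have := xk i; have := h i.
rewrite exp2zE => /andP[+ +] /andP[].
rewrite -lezD1 -!(ler_int R) intrD.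
by move=> ? ? ? ?; apply/andP; split; lra.
Qed.

Lemma cell_sub_bspline_cube p l k m :
  cell (R:=R) l k `<=` bspline_cube p l m <->
  forall i, m i <= k i <= m i + p%:Z.
Proof.
split=> [h i|h x /in_cell xk].
  have /in_bspline_cube/(_ i) := h _ (cell_center_in _ k).
  by rewrite cell_centerE -[p%:R]/((p%:Z)%:~R) -intrD half_itv.
apply/in_bspline_cube => i; have := xk i; have /andP[] := h i.
by rewrite -!(ler_int R) intrD => ? ? /andP[? ?]; apply/andP; split; lra.
Qed.

End Cells.

(** * Supports of B-splines *)

Section Bsplines.
Variable R : realType.

Lemma cardinal_bspline_neq0 p (t : R) :
  cardinal_bspline p t != 0 -> 0 <= t <= p%:R + 1.
Proof.
elim: p t => [|q IH] t /=.
  by case: ifP => [/andP[? ?] _|_]; [apply/andP; split; lra | rewrite eqxx].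
have [B0|/IH Bt _] := eqVneq (cardinal_bspline q t) 0; last first.
  by rewrite -natr1; apply/andP; split; lra.
have [B1|/IH Bt _] := eqVneq (cardinal_bspline q (t - 1)) 0.
  by rewrite B0 B1 !mulr0 add0r mul0r eqxx.
by rewrite -natr1; apply/andP; split; lra.
Qed.

Lemma cardinal_bspline_ge0 p (t : R) : 0 <= cardinal_bspline p t.
Proof.
elim: p t => [|q IH] t /=; first by case: ifP.
rewrite divr_ge0// addr_ge0//.
  have [->|/cardinal_bspline_neq0 h] := eqVneq (cardinal_bspline q t) 0.
    by rewrite mulr0.
  by rewrite mulr_ge0//; lra.
have [->|/cardinal_bspline_neq0 h] := eqVneq (cardinal_bspline q (t - 1)) 0.
  by rewrite mulr0.
by rewrite mulr_ge0// -[q.+2%:R]natr1 -natr1; lra.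
Qed.

Lemma cardinal_bspline_gt0 p (t : R) :
  0 < t < p%:R + 1 -> 0 < cardinal_bspline p t.
Proof.
elim: p t => [|q IH] t /= t0p.
  by rewrite ifT ?ltr01//; lra.
have q0 : 0 <= q%:R :> R by [].
rewrite -[q.+2%:R]natr1 -natr1 in t0p *.
apply: divr_gt0; last by lra.
have h0 := cardinal_bspline_ge0 q t.
have h1 := cardinal_bspline_ge0 q (t - 1).
have [tq|qt] := ltP t (q%:R + 1).
  have B : 0 < cardinal_bspline q t by apply: IH; lra.
  by rewrite ltr_pwDl ?mulr_gt0 ?mulr_ge0//; lra.
have B : 0 < cardinal_bspline q (t - 1).
  (* The constant spline does not vanish at its left knot, which is the
     value of t - 1 when t = 1. *)
  case: q IH q0 t0p h0 h1 qt => [|q] IH q0 t0p h0 h1 qt.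
    by rewrite /= ifT ?ltr01//; lra.
  have := ler0n R q; rewrite -natr1 in t0p qt IH *.
  by move=> ?; apply: IH; lra.
by rewrite ltr_wpDl ?mulr_gt0 ?mulr_ge0//; lra.
Qed.

Variable d : nat.
Implicit Types (k m : 'I_d -> int) (x : 'rV[R]_d).

Lemma closed_box (a b : 'I_d -> R) :
  closed [set x : 'rV[R]_d | forall i, a i <= x 0 i <= b i].
Proof.
rewrite (_ : mkset _ =
    \bigcap_i ((fun x : 'rV[R]_d => x 0 i) @^-1` `[a i, b i])); last first.
  apply/seteqP; split=> x /= h i; first by move=> _ /=; rewrite in_itv /=.
  by have := h i I; rewrite /= in_itv.
apply: closed_bigI => i _; apply: closed_comp; last exact: itv_closed.
by move=> x _; exact: coord_continuous.
Qed.

Definition restricted_bspline p l k : 'rV[R]_d -> R :=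
  patch (fun=> 0) (@unit_cube R d) (tensor_bspline p l k).

Lemma restricted_bspline_neq0 p l k x : restricted_bspline p l k x != 0 <->
  unit_cube x /\
  forall i, cardinal_bspline p (x 0 i * 2 ^ l%:Z - (k i)%:~R) != 0.
Proof.
rewrite /restricted_bspline patchE; case: ifPn; rewrite ?inE ?notin_setE => xU.
  split=> [/prodf_neq0 h|[_ h]]; first split=> // i.
    by have := h i isT; rewrite mulrC -exprnP.
  by apply/prodf_neq0 => i _; have := h i; rewrite mulrC -exprnP.
by split=> [|[]//]; rewrite eqxx.
Qed.

Lemma supp_restricted_bspline_sub p l k :
  supp (restricted_bspline p l k) `<=` bspline_cube p l%:Z k `&` @unit_cube R d.
Proof.
have /closure_id -> : closed (bspline_cube p l%:Z k `&` @unit_cube R d).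
  by apply: closedI; exact: closed_box.
apply: closureS => x /= /restricted_bspline_neq0[xU h]; split=> //.
apply/in_bspline_cube => i; have := cardinal_bspline_neq0 (h i).
by move=> ?; apply/andP; split; lra.
Qed.

(** Every point x of the convex set on the left is the limit of points strictly
    between x and the centre of the cell; since that centre is interior to the
    spline cube, these points lie in the open cube on which the tensor product
    is positive. *)
Lemma sub_supp_restricted_bspline p (l : nat) k m :
  cell (R:=R) l%:Z k `<=` @unit_cube R d ->
  cell (R:=R) l%:Z k `<=` bspline_cube p l%:Z m ->
  bspline_cube p l%:Z m `&` @unit_cube R d `<=` supp (restricted_bspline p l m).
Proof.
move=> kU /cell_sub_bspline_cube km x [/in_bspline_cube xm xU] B Bx.
pose c := cell_center R l%:Z k.
have cU : unit_cube c by apply: kU; exact: cell_center_in.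
pose y (t : R) := x + t *: (c - x).
have yE t i : y t 0 i = x 0 i + t * (c 0 i - x 0 i) by rewrite !mxE.
have ycvg : y t @[t --> 0^'+] --> x.
  rewrite -[X in _ --> X]addr0 -(scale0r (c - x)).
  apply: cvgD; first exact: cvg_cst.
  apply: cvgZr_tmp; exact: cvg_within.
have near_x : \forall t \near 0^'+, [/\ B (y t), 0 < t & t < 1].
  near=> t; split; near: t; [exact: ycvg|exact: nbhs_right_gt|].
  exact: nbhs_right_lt.
have [t [Byt t0 t1]] :=
  @filter_ex _ _ (at_right_proper_filter 0) _ near_x.
exists (y t); split=> //=.
apply/restricted_bspline_neq0; split=> i.
  rewrite yE; move: (xU i) (cU i) => /andP[? ?] /andP[? ?].
  by apply/andP; split; nra.
rewrite gt_eqF// cardinal_bspline_gt0//.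
have -> : y t 0 i * 2 ^ l%:Z =
    x 0 i * 2 ^ l%:Z + t * ((k i)%:~R + 2^-1 - x 0 i * 2 ^ l%:Z).
  by rewrite yE -(cell_centerE R l%:Z k i) -/c; ring.
have := xm i; move: (x 0 i * _) => X /andP[mX Xm].
have /andP[] := km i; rewrite -!(ler_int R) intrD => mk kmp.
by apply/andP; split; nra.
Unshelve. all: by end_near. Qed.

(** A spline cube that meets the unit cube only in a face contains no cell of
    the unit cube, so every spline cube used by the hat does come from a basis
    function. *)
Lemma support_extensionE p (l : nat) k :
  cell (R:=R) l%:Z k `<=` @unit_cube R d ->
  support_extension p l (cell (R:=R) l%:Z k) =
  hat p l%:Z (cell l%:Z k) `&` @unit_cube R d.
Proof.
move=> kU; apply/seteqP; split=> x.
  move=> [b /= [[[m ->] _] Qb] /supp_restricted_bspline_sub[xm xU]].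
  split=> //; exists (bspline_cube p l%:Z m) => //; split; first by exists m.
  by move=> y /Qb/supp_restricted_bspline_sub[].
move=> [[_ [[m ->] Qm] xm] xU].
have sub := sub_supp_restricted_bspline kU Qm.
exists (restricted_bspline p l m); last exact: sub.
split; last by move=> y Qy; apply: sub; split; [exact: Qm|exact: kU].
split; first by exists m.
have [y [/= ? _]] := sub _ (conj xm xU) _ filterT.
by exists y.
Qed.

(** * Hats and neighbourhoods *)

(** Two cells lie in a common spline cube exactly when their indices differ by
    at most p in every direction. *)
Lemma cell_sub_hat p (l : int) k m : cell (R:=R) l m `<=` hat p l (cell l k) <->
  forall i, k i - p%:Z <= m i <= k i + p%:Z.
Proof.
split=> [h i|h].
  have [_ [[j ->] kj] mj] := h _ (cell_center_in R l m).
  have := (cell_sub_bspline_cube R p l k j).1 kj i.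
  have /in_bspline_cube/(_ i) := mj.
  by rewrite cell_centerE -[p%:R]/((p%:Z)%:~R) -intrD half_itv; lia.
pose j i := Num.min (k i) (m i).
apply: (@subset_trans _ (bspline_cube p l j)).
  by apply/cell_sub_bspline_cube => i; have := h i; rewrite /j; lia.
move=> x xj; exists (bspline_cube p l j) => //; split; first by exists j.
by apply/cell_sub_bspline_cube => i; have := h i; rewrite /j; lia.
Qed.

Lemma bspline_cube_covered p (l : int) j x : bspline_cube p l j x ->
  exists2 m, cell (R:=R) l m `<=` bspline_cube p l j & cell l m x.
Proof.
move=> /in_bspline_cube xj.
(* The floor is capped so that points of the right faces of the cube get the
   last cell of the cube. *)
pose m i := Num.min (Num.floor (x 0 i * 2 ^ l)) (j i + p%:Z).
exists m.
  apply/cell_sub_bspline_cube => i; have /andP[jx _] := xj i.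
  move: jx; rewrite -floor_ge_int /m; move: (Num.floor _) => f jf.
  by apply/andP; split; lia.
apply/in_cell => i; have /andP[jx xjp] := xj i; rewrite /m.
have := Num.Theory.floor_le (x 0 i * 2 ^ l); have := floorD1_gt (x 0 i * 2 ^ l).
move: (Num.floor _) => f; rewrite intrD => xf fx.
case: (leP f) => [_|/ltW]; first by apply/andP; split; lra.
by rewrite -(ler_int R) intrD => ?; apply/andP; split; lra.
Qed.

Lemma hat_sub_neighbourhood p (l : int) k :
  hat p l (cell l k) `<=` neighbourhood p l (cell (R:=R) l k).
Proof.
move=> x [_ [[j ->] kj] /bspline_cube_covered[m mj xm]].
exists (cell l m); last by rewrite parent_cell; exact: cell_sub_half.
split; first by exists m.
move=> y /mj yj; exists (bspline_cube p l j) => //.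
by split=> //; exists j.
Qed.

(** The centre is interior to the parent, so the member of F that contains it
    can only be the parent. *)
Lemma center_in_union_parent l k (F : set (set 'rV[R]_d)) :
  F `<=` cells (l - 1) ->
  (\bigcup_(Q in F) Q) (cell_center R l k) ->
  F (parent l (cell l k)).
Proof.
move=> Fl [_ /[dup] /Fl[m ->] Fm /center_in_parent mk].
by rewrite parent_cell -mk.
Qed.

(** A cell of the hat may leave the unit cube. Clamping its indices keeps it in
    the hat. In a direction where clamping changes the index, a parent outside
    the unit interval meets that interval at most in an endpoint, which the
    parent of the clamped cell contains too. *)
Lemma neighbourhood_clamp p (l : nat) k x : (0 < l)%N ->
  cell (R:=R) l%:Z k `<=` @unit_cube R d ->
  neighbourhood p l%:Z (cell l%:Z k) x -> unit_cube x ->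
  exists2 m, cell (R:=R) l%:Z m `<=` hat p l%:Z (cell l%:Z k) `&` @unit_cube R d
    & parent l%:Z (cell l%:Z m) x.
Proof.
case: l => // l _ /cell_sub_unit_cube k01 [_ [[j ->] /cell_sub_hat jk]].
rewrite parent_cell => xj xU.
have lE : l.+1%:Z - 1 = l%:Z by lia.
pose K := (2 ^ l)%N%:Z.
have KE : (2 ^ l.+1)%N%:Z = 2 * K by rewrite /K expnS PoszM.
have K0 : 0 < K by rewrite /K ltz_nat expn_gt0.
pose m i := Num.max 0 (Num.min (j i) (2 * K - 1)).
exists m.
  rewrite subsetI; split.
    apply/cell_sub_hat => i; have := jk i; have := k01 i; rewrite KE /m; lia.
  by apply/cell_sub_unit_cube => i; rewrite KE /m; lia.
rewrite parent_cell lE; move: xj; rewrite lE => /in_cell xj; apply/in_cell => i.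
have := xj i; have /(in_unit_cube l)/(_ i) := xU; rewrite exp2zE -/K.
move: (x 0 i * _) => y /andP[y0 yK] /andP[jy yj].
have [j0|j0] := ltP (j i) 0.
  have -> : (m i %/ 2)%Z = 0 by rewrite /m; lia.
  have : ((j i %/ 2)%Z + 1)%:~R <= (0 : int)%:~R :> R by rewrite ler_int; lia.
  by rewrite intrD => ?; apply/andP; split; lra.
have [jK|jK] := ltP (j i) (2 * K).
  by have -> : m i = j i by [rewrite /m; lia]; apply/andP; split; lra.
have -> : (m i %/ 2)%Z = K - 1 by rewrite /m; lia.
have : K%:~R <= (j i %/ 2)%Z%:~R :> R by rewrite ler_int; lia.
by rewrite intrB => ?; apply/andP; split; lra.
Qed.

End Bsplines.

(** * Weak admissibility *)

Theorem theorem2p20 (R : realType) (d p n : nat) (hd : (1 <= d)%N)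
    (hp : (1 <= p)%N) (Omega : nat -> set 'rV[R]_d)
    (hOmega : is_hierarchy n Omega) (M : set (set 'rV[R]_d))
    (hM : M = hierarchical_mesh n Omega) :
  weakly_admissible p n Omega M <->
  (forall (l : nat) (Q : set 'rV[R]_d), (1 <= l <= n - 1)%N ->
     cells_in l Q -> Q `<=` omega p Omega l ->
     neighbourhood p (l%:Z - 1) (parent l%:Z Q) `&` Omega 0%N
       `<=` Omega l.-1).
Proof.
have O0 := hierarchy_first hOmega.
have half_in (l : nat) (k : 'I_d -> int) :
    cell (R:=R) l.+1%:Z k `<=` @unit_cube R d ->
    cell (R:=R) l%:Z (fun i => (k i %/ 2)%Z) `<=` @unit_cube R d.
  move=> /cell_sub_unit_cube h; apply/cell_sub_unit_cube => i.
  by have := h i; rewrite expnS PoszM; lia.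
have predE (l : nat) : l.+1%:Z - 1 = l%:Z by lia.
split=> [[_ adm]|nbhd].
  move=> [//|[Q _ _ _ x []//|l]] Q ln [[k ->] kU] Qomega /=.
  rewrite parent_cell predE O0.
  set m := fun i => _ : int; have mU := half_in _ _ kU; rewrite -/m in mU.
  have := adm l.+2 _ _ (Qomega _ (cell_center_in R l.+2%:Z k)).
  move=> /(_ ltac:(lia)) [_ [[[m' ->] _]]].
  rewrite -[X in cell X]predE => + /center_in_parent mE.
  rewrite mE predE support_extensionE// => ext x [xN xU].
  have [//|j /subset_trans/(_ ext) jO] := neighbourhood_clamp _ mU xN xU.
  have [|F Fl OE] := hierarchy_cells hOmega (l := l.+1); first by lia.
  move=> xj; rewrite OE; exists (parent l.+1%:Z (cell l.+1%:Z j)) => //.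
  apply: center_in_union_parent => //; rewrite -OE.
  by apply: jO; exact: cell_center_in.
split=> // -[//|l] ln x [_ [[[k ->] kU] ext] xk] /=.
have mU := half_in _ _ kU; set m := fun i => _ : int in mU.
exists (cell l%:Z m); last first.
  by rewrite -predE; exact: cell_sub_half.
split; first by split=> //; exists m.
rewrite support_extensionE// => y [ym yU].
apply: (nbhd l.+1 (cell l.+1%:Z k)).
- by lia.
- by split=> //; exists k.
- move=> z zk; exists (cell l.+1%:Z k) => //.
  by split=> //; split=> //; exists k.
- rewrite parent_cell predE O0; split=> //; exact: hat_sub_neighbourhood.
Qed.
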